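(* Let $m,n\ge 3$ be integers with $\gcd(m,n)=1$, and let $\Gamma$ be an Abelian group of order $mn$. There exists a $\Gamma$-distance magic labeling of the Cartesian product $C_m\square C_n$ if and only if $mn$ is even and either $\Gamma\cong\mathbb{Z}_2\times\mathbb{Z}_{mn/2}$ or $\Gamma\cong\mathbb{Z}_{mn}$.
   Context: $C_k$ denotes the cycle on $k\ge 3$ vertices. The Cartesian product $G\square H$ of graphs $G,H$ has vertex set $V(G)\times V(H)$; $(g,h)$ and $(g',h')$ are adjacent iff either $g=g'$ and $h$ is adjacent to $h'$ in $H$, or $h=h'$ and $g$ is adjacent to $g'$ in $G$. For a finite simple graph $G=(V,E)$ and an Abelian group $\Gamma$ (written additively) with $|\Gamma|=|V|$, a $\Gamma$-distance magic labeling of $G$ is a bijection $\ell\colon V\to\Gamma$ for which there exists $\mu\in\Gamma$ such that $\sum_{u\in N(v)}\ell(u)=\mu$ for every $v\in V$, where $N(v)$ is the open neighborhood of $v$. *)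

(* Defs.v *)
From HB Require Import structures.
From mathcomp Require Import all_boot all_order all_algebra.

Set Implicit Arguments.
Unset Strict Implicit.
Unset Printing Implicit Defensive.

Import GRing.Theory.
Local Open Scope ring_scope.

(* A finite simple graph is a symmetric irreflexive relation on a finType. *)
Definition simple_graph (T : finType) (e : rel T) : Prop :=
  symmetric e /\ irreflexive e.

(* [ordS] is the successor modulo k. *)
Definition cycle_graph (k : nat) : rel 'I_k :=
  fun i j => (j == ordS i) || (i == ordS j).

Definition cartesian_product (T U : finType) (e : rel T) (f : rel U) :
    rel (T * U) :=
  fun x y => (x.1 == y.1) && f x.2 y.2 || (x.2 == y.2) && e x.1 y.1.

Definition open_neighborhood (T : finType) (e : rel T) (v : T) : {set T} :=
  [set u | e v u].

(* The requirement that the group and the vertex set have equal cardinality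
   is implied by bijectivity. *)
Definition distance_magic_labeling (T : finType) (e : rel T)
    (Gamma : finZmodType) (l : T -> Gamma) : Prop :=
  bijective l /\
  exists mu : Gamma,
    forall v : T, \sum_(u in open_neighborhood e v) l u = mu.

Definition isomorphic_zmod (U V : zmodType) : Prop :=
  exists f : {additive U -> V}, bijective f.

Lemma cycle_graph_simple (k : nat) : (2 < k)%N -> simple_graph (@cycle_graph k).
Proof.
move=> k_gt2; split=> [i j | i]; first by rewrite /cycle_graph orbC.
rewrite /cycle_graph orbb; apply/negP => /eqP /(congr1 val) /=.
have := ltn_ord i; rewrite leq_eqVlt => /orP[/eqP eq_k | lt_k].
  by rewrite eq_k modnn => i0; move: k_gt2; rewrite -eq_k i0.
by rewrite modn_small // => /eqP; rewrite -{1}[val i]addn0 -addn1 eqn_add2l.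
Qed.

Lemma cartesian_product_simple (T U : finType) (e : rel T) (f : rel U) :
  simple_graph e -> simple_graph f -> simple_graph (cartesian_product e f).
Proof.
move=> [e_sym e_irr] [f_sym f_irr]; split=> [x y | x].
  rewrite /cartesian_product e_sym f_sym.
  by rewrite [x.1 == _]eq_sym [x.2 == _]eq_sym.
by rewrite /cartesian_product e_irr f_irr !andbF.
Qed.

(* Main.v *)
Require Import Defs.
From HB Require Import structures.
From mathcomp Require Import all_boot all_order all_algebra.

Set Implicit Arguments.
Unset Strict Implicit.
Unset Printing Implicit Defensive.

Import GRing.Theory.
Local Open Scope ring_scope.

(** Writing [x] and [y] for the shifts by [(1, 0)] and [(0, 1)] on
    [Z_m * Z_n], the neighborhood sum operator factors as
    [x + x^-1 + y + y^-1 = x^-1 (1 + x y) (1 + x y^-1)].  As [m] and [n] are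
    coprime, [s = (1, -1)] and [t = (1, 1)] both generate the vertex group of
    order [N = mn].  Since [s + s] is an even multiple of [t], the magic
    condition makes [l v + l (v + s)] invariant under [s + s]; along the
    multiples of [s] a magic labeling is thus [l (2k s) = l 0 + k d],
    [l ((2k+1) s) = l s - k d] for a fixed [d].  Injectivity then forces [N]
    to be even, [d] to have order [N/2], and [l s - l 0] to lie outside the
    subgroup generated by [d]; conversely, such data define a magic labeling.
    The abelian groups of even order [N] with a cyclic subgroup of index two are
    [Z_N] and [Z_2 * Z_(N/2)]. *)

(** * Orders of elements and isomorphisms of finite groups *)

HB.instance Definition _ (U V : finZmodType) := GRing.Zmodule.on (U * V)%type.

Definition has_order (V : zmodType) (w : V) (p : nat) : Prop :=
  forall k, (w *+ k == 0) = (p %| k)%N.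

Lemma has_order_eq (V : zmodType) (w : V) p i j :
  has_order w p -> (w *+ i == w *+ j) = (i == j %[mod p]).
Proof.
move=> ow; wlog le_ij : i j / (i <= j)%N => [th|].
  by case/orP: (leq_total i j) => /th // e; rewrite eq_sym e eq_sym.
by rewrite eq_sym [RHS]eq_sym eqn_mod_dvd // -ow mulrnBr // subr_eq0.
Qed.

Lemma has_order_opp (V : zmodType) (w : V) p k :
  has_order w p -> (0 < p)%N -> exists j, - (w *+ k) = w *+ j.
Proof.
move=> ow p_gt0; exists (k * p.-1)%N; apply/eqP.
by rewrite eq_sym -addr_eq0 -mulrnDr -mulnSr prednK // ow dvdn_mull.
Qed.

Lemma has_order_generates (V : finZmodType) (w : V) :
  has_order w #|V| -> forall v, exists k, v = w *+ k.
Proof.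
move=> ow v.
have inj : injective (fun i : 'I_#|V| => w *+ i).
  move=> i j /eqP; rewrite (has_order_eq _ _ ow) !modn_small // => /eqP; exact: val_inj.
have [g _ gK] := inj_card_bij inj (eq_leq (esym (card_ord _))).
by exists (g v); rewrite gK.
Qed.

(** The isomorphism produced is the inverse of [f]: homomorphisms out of ['Z_p] are easy to write
    down, while the goal asks for maps into it. *)
Lemma isomorphic_of_trivial_kernel (U : finZmodType) (V : finZmodType)
    (f : {additive U -> V}) :
  (forall x, f x = 0 -> x = 0) -> #|V| = #|U| -> isomorphic_zmod V U.
Proof.
move=> ker0 cVU.
have f_inj : injective f.
  by move=> x y e; apply/eqP; rewrite -subr_eq0 (ker0 (x - y)) // raddfB e subrr.
have [g fK gK] := inj_card_bij f_inj (eq_leq cVU).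
have g_add : zmod_morphism g by move=> x y; apply: f_inj; rewrite raddfB !gK.
pose G : {additive V -> U} :=
  HB.pack g (GRing.isZmodMorphism.Build V U g g_add).
by exists G; exists f.
Qed.

Lemma mulrn_mod (V : zmodType) (a : V) p k : a *+ p = 0 -> a *+ (k %% p) = a *+ k.
Proof.
by move=> ap0; rewrite [in RHS](divn_eq k p) mulrnDr mulnC mulrnA ap0 mul0rn add0r.
Qed.

Lemma additive_of_mulrn_Zp (V : zmodType) (a : V) p :
  (1 < p)%N -> a *+ p = 0 -> zmod_morphism (fun x : 'Z_p => a *+ x).
Proof.
move=> p_gt1 ap0 x y; apply/eqP; rewrite eq_sym subr_eq -mulrnDr; apply/eqP.
rewrite -[RHS](mulrn_mod _ ap0) -[x in LHS](subrK y); congr (_ *+ _).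
by rewrite [LHS]/=; congr (_ %% _)%N; rewrite Zp_cast.
Qed.

Lemma dvdn_Zp_eq0 p (x : 'Z_p) : (1 < p)%N -> (p %| x)%N -> x = 0.
Proof.
by move=> p_gt1 /eqP px; apply: val_inj; rewrite -(natr_Zp x) /= val_Zp_nat.
Qed.

Lemma cyclic_isomorphic_Zp (V : finZmodType) (w : V) p :
  (1 < p)%N -> #|V| = p -> has_order w p -> isomorphic_zmod V 'Z_p.
Proof.
move=> p_gt1 cV ow.
have wp0 : w *+ p = 0 by apply/eqP; rewrite ow.
pose f : {additive 'Z_p -> V} := HB.pack (fun x : 'Z_p => w *+ x)
  (GRing.isZmodMorphism.Build 'Z_p V _ (additive_of_mulrn_Zp p_gt1 wp0)).
apply: (@isomorphic_of_trivial_kernel _ _ f) => [x /eqP|].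
  by rewrite /= ow => /dvdn_Zp_eq0 ->.
by rewrite cV card_ord Zp_cast.
Qed.

(** The map sending [(x, y)] to [b *+ x + d *+ y] is additive because [2b = 0] and [pd = 0]; a
    kernel element with [x = 1] would make [b] a multiple of [d]. *)
Lemma split_isomorphic_Z2Zp (V : finZmodType) (b d : V) p :
    (1 < p)%N -> #|V| = (2 * p)%N -> has_order d p -> b *+ 2 = 0 ->
  (forall k, b <> d *+ k) -> isomorphic_zmod V ('Z_2 * 'Z_p)%type.
Proof.
move=> p_gt1 cV od b2 bNd.
have dp0 : d *+ p = 0 by apply/eqP; rewrite od.
have f_add : zmod_morphism (fun x : 'Z_2 * 'Z_p => b *+ x.1 + d *+ x.2).
  move=> x y; rewrite [(x - y).1]/= [(x - y).2]/=.
  rewrite (additive_of_mulrn_Zp (isT : 1 < 2)%N b2) (additive_of_mulrn_Zp p_gt1 dp0).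
  by rewrite addrACA opprD.
pose f : {additive 'Z_2 * 'Z_p -> V} := HB.pack (fun x : 'Z_2 * 'Z_p => b *+ x.1 + d *+ x.2)
  (GRing.isZmodMorphism.Build _ _ _ f_add).
apply: (@isomorphic_of_trivial_kernel _ _ f) => [[x y] /= /eqP|].
  case: x => -[|[|//]] lx /=.
    by rewrite mulr0n add0r od => /dvdn_Zp_eq0 -> //; congr (_, _); apply: val_inj.
  rewrite addr_eq0 mulr1n => /eqP.
  by have [j ->] := has_order_opp y od (ltnW p_gt1) => /bNd.
by rewrite cV card_prod !card_ord (Zp_cast p_gt1).
Qed.

(** For even [#|V|], [d] generates a subgroup of index two and [b] represents its other coset. *)
Definition index2_cyclic (V : finZmodType) :=
  exists d b : V, has_order d #|V|./2 /\ (forall k, b <> d *+ k).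

Lemma index2_cyclic_isomorphic (V : finZmodType) p :
    (1 < p)%N -> #|V| = (2 * p)%N -> index2_cyclic V ->
  isomorphic_zmod V ('Z_2 * 'Z_p)%type \/ isomorphic_zmod V 'Z_(2 * p).
Proof.
move=> p_gt1 cV [d [b [+ bNd]]]; rewrite cV => od.
rewrite mul2n doubleK in od.
have p_gt0 := ltnW p_gt1.
have shiftNd j : forall k, b - d *+ j <> d *+ k.
  by move=> k /eqP; rewrite subr_eq -mulrnDr => /eqP /bNd.
have bDNd i j : b + d *+ i <> d *+ j.
  move=> /eqP; rewrite -subr_eq0 -addrA addr_eq0 opprB => /eqP.
  have [k dk] := has_order_opp i od p_gt0.
  by rewrite dk -mulrnDr => /bNd.
(* These [2p] elements are distinct, so they exhaust [V]; hence [2b] lies in one of the two cosets,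
   and it cannot lie in that of [b]. *)
have inj : injective (fun x : bool * 'I_p => b *+ x.1 + d *+ x.2).
  move=> [x i] [y j] /=; case: x y => [] [] /=; rewrite ?mulr0n ?mulr1n ?add0r.
  - by move=> /addrI /eqP; rewrite (has_order_eq _ _ od) !modn_small // => /eqP e;
       congr (_, _); apply: val_inj.
  - by move/bDNd.
  - by move/esym/bDNd.
  - by move=> /eqP; rewrite (has_order_eq _ _ od) !modn_small // => /eqP e;
       congr (_, _); apply: val_inj.
have [|g _ gK] := inj_card_bij inj; first by rewrite card_prod card_bool card_ord cV.
have [k b2] : exists k, b *+ 2 = d *+ k.
  have := gK (b *+ 2); case: (g _) => [[] i] /= e; exists i.
    by case: (bNd i); apply: (addrI b); rewrite -mulr2n -e.
  by rewrite -e add0r.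
(* If 2b = kd, then b' = b - (k/2)d satisfies 2b' = 0 or 2b' = d. *)
have b'2 : (b - d *+ k./2) *+ 2 = d *+ odd k.
  by rewrite mulrnBl b2 -mulrnA muln2 -{1}(odd_double_half k) mulrnDr addrK.
set b' := b - _ in b'2; case: (odd k) b'2 => b'2; last first.
  left; apply: (split_isomorphic_Z2Zp p_gt1 cV od b'2).
  exact: shiftNd.
right; apply: (@cyclic_isomorphic_Zp _ b') => //.
  by apply: leq_trans p_gt1 _; rewrite leq_pmull.
(* Here [2b' = d]: the multiple of [b'] by [2j] is [jd], and an odd multiple [b' + jd] never
   vanishes. *)
move=> i; have := odd_double_half i; move: (odd i) i./2 => e j <- {i}.
rewrite -mul2n mulrnDr mulrnA b'2 mulr1n; case: e => /=.
  rewrite mulr1n; apply/idP/idP => [|/dvdnP[i /(congr1 odd)]].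
    rewrite addr_eq0 => /eqP.
    by have [i ->] := has_order_opp j od p_gt0 => /shiftNd.
  by rewrite oddD mulnCA !oddM.
by rewrite mulr0n !add0r add0n od dvdn_pmul2l.
Qed.

Lemma isomorphic_index2_cyclic (V : finZmodType) p :
    (1 < p)%N -> #|V| = (2 * p)%N ->
  isomorphic_zmod V ('Z_2 * 'Z_p)%type \/ isomorphic_zmod V 'Z_(2 * p) ->
  index2_cyclic V.
Proof.
move=> p_gt1 cV [] [f [g fK gK]]; rewrite /index2_cyclic cV mul2n doubleK.
  exists (g (0, 1)), (g (1, 0)); split=> [k|k e].
    rewrite -(inj_eq (can_inj fK)) raddfMn raddf0 gK pairMnE mul0rn.
    by rewrite xpair_eqE eqxx /= -val_eqE /= val_Zp_nat.
  by have := congr1 (fun x => (f x).1) e; rewrite /= raddfMn !gK pairMnE mul0rn.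
have p2_gt1 : (1 < 2 * p)%N by apply: leq_trans p_gt1 _; rewrite leq_pmull.
exists (g 2%:R), (g 1); split=> [k|k e].
  rewrite -(inj_eq (can_inj fK)) raddfMn raddf0 gK -mulrnA.
  by rewrite -val_eqE /= val_Zp_nat // -/(dvdn _ _) dvdn_pmul2l.
(* Parity is well defined modulo the even number [2 * p], and separates [1] from the multiples of
   [2]. *)
have := congr1 (fun x => odd (f x)) e.
rewrite raddfMn !gK -mulrnA -[1]/(1%:R) !val_Zp_nat //.
by rewrite !odd_mod ?oddM.
Qed.

Lemma index2_cyclic_iff (V : finZmodType) N :
    (2 < N)%N -> #|V| = N -> ~~ odd N ->
  index2_cyclic V <->
  isomorphic_zmod V ('Z_2 * 'Z_(N %/ 2))%type \/ isomorphic_zmod V 'Z_N.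
Proof.
move=> + + N_even; have : N = (2 * (N %/ 2))%N by rewrite divn2 mul2n even_halfK.
move: (N %/ 2)%N => p -> p2_gt2 cV.
(* Needed because ['Z_p] has [p] elements only for [p > 1]; ['Z_0] and ['Z_1] have two. *)
have p_gt1 : (1 < p)%N by move: p2_gt2; case: p {N_even cV} => [|[]].
split; [exact: index2_cyclic_isomorphic | exact: isomorphic_index2_cyclic].
Qed.

(** * Magic labelings in terms of two generators *)

(* For [s = (1, -1)] and [t = (1, 1)] the four points are the neighbors of
   [v + (1, 0)]. *)
Definition magic_for_generators (V Gamma : zmodType) (s t : V) (l : V -> Gamma) :=
  exists mu, forall v, (l v + l (v + s)) + (l (v + t) + l (v + t + s)) = mu.

Lemma magic_index2_cyclic (V Gamma : finZmodType) (s t : V) (l : V -> Gamma) :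
    (2 < #|V|)%N -> #|Gamma| = #|V| -> has_order s #|V| -> has_order t #|V| ->
    injective l -> magic_for_generators s t l ->
  ~~ odd #|V| /\ index2_cyclic Gamma.
Proof.
move=> N_gt2 cG os ot l_inj [mu lmu]; rewrite /index2_cyclic cG.
set N := #|V| in N_gt2 os ot *.
pose h k := l (s *+ k).
have h_eq i j : (h i == h j) = (i == j %[mod N]).
  by rewrite (inj_eq l_inj) (has_order_eq _ _ os).
have hN k : h (k + N)%N = h k by apply/eqP; rewrite h_eq modnDr.
(* The magic equations at [v] and [v + t] share the pair sum at [v + t], which cancels. *)
have per v : l (v + t *+ 2) + l (v + t *+ 2 + s) = l v + l (v + s).
  apply: (addrI (l (v + t) + l (v + t + s))).
  have -> : v + t *+ 2 = v + t + t by rewrite mulr2n addrA.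
  by rewrite lmu [RHS]addrC lmu.
have perE j v : l (v + t *+ j.*2) + l (v + t *+ j.*2 + s) = l v + l (v + s).
  elim: j => [|j IH]; first by rewrite addr0.
  by rewrite doubleS -addn2 mulrnDr addrA per.
have h_rec k : h k.+2 + h k.+3 = h k + h k.+1.
  rewrite /h !mulrSr -!addrA -[s + s]mulr2n.
  have [j sj] := has_order_generates ot s.
  have s2 : s *+ 2 = t *+ j.*2 by rewrite sj -mulrnA muln2.
  by rewrite [s + (s + s)]addrA -mulr2n s2 addrA perE.
have h_step k x : h k.+2 = h k + x -> h k.+3 = h k.+1 - x.
  by move=> hk; apply: (addrI (h k.+2)); rewrite h_rec hk addrACA subrr addr0.
have [d h2] : exists d, h 2 = h 0 + d by exists (h 2 - h 0); rewrite addrC subrK.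
have h_step2 k : h k.*2.+2 = h k.*2 + d.
  elim: k => [|k /h_step/h_step]; first exact: h2.
  by rewrite opprK.
have h_even k : h k.*2 = h 0 + d *+ k.
  elim: k => [|k IH]; first by rewrite addr0.
  by rewrite doubleS h_step2 IH mulrSr addrA.
have h_odd k : h k.*2.+1 = h 1 - d *+ k.
  elim: k => [|k IH]; first by rewrite subr0.
  by rewrite doubleS (h_step _ _ (h_step2 k)) IH mulrSr opprD addrA.
have Nodd : ~~ odd N.
  apply/negP => oddN; have defN := odd_double_half N; rewrite oddN add1n in defN.
  (* With [N = 2M + 1], period [N] gives [h 1 - Md = h 0] and [h 0 + (M + 1)d = h 1], so [d = 0] and
     [h 2 = h 0], impossible for [N > 2]. *)
  have e0 := hN 0; have e1 := hN 1; rewrite add0n -defN h_odd in e0.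
  rewrite add1n -defN -doubleS h_even mulrSr addrA -e0 subrK in e1.
  have d0 : d = 0 by apply: (addrI (h 1)); rewrite addr0.
  have : h 2 == h 0 by rewrite h2 d0 addr0.
  by rewrite h_eq mod0n modn_small.
have defN : N = N./2.*2 by rewrite -[LHS]odd_double_half (negbTE Nodd).
split=> //; exists d, (h 1 - h 0); split=> k.
  rewrite -(inj_eq (addrI (h 0))) -h_even addr0 h_eq mod0n -/(dvdn _ _) defN.
  by rewrite -!mul2n dvdn_pmul2l // mul2n -defN.
(* If [h 1 - h 0] were [kd], then [h 1 = h (2k)], so [1] and [2k] would agree modulo the even
   [N]. *)
move=> /eqP; rewrite subr_eq addrC -h_even h_eq => /eqP /(congr1 odd).
by rewrite !odd_mod ?odd_double // (negbTE Nodd).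
Qed.

Lemma index2_cyclic_magic (V Gamma : finZmodType) (s t : V) :
    (2 < #|V|)%N -> #|Gamma| = #|V| -> has_order s #|V| -> has_order t #|V| ->
    ~~ odd #|V| -> index2_cyclic Gamma ->
  exists l : V -> Gamma, bijective l /\ magic_for_generators s t l.
Proof.
move=> N_gt2 cG os ot Nodd [d [b []]]; rewrite cG => od bNd.
set N := #|V| in N_gt2 os ot Nodd od *.
have defN : N = N./2.*2 by rewrite -[LHS]odd_double_half (negbTE Nodd).
have M_gt0 : (0 < N./2)%N by rewrite half_gt0 ltnW.
(* The general form of a magic labeling, normalized to [l 0 = 0] and [l s = b]. *)
pose h k := if odd k then b - d *+ k./2 else d *+ k./2.
have h_neq i j : (b - d *+ i == d *+ j) = false.
  by apply/eqP => /eqP; rewrite subr_eq -mulrnDr => /eqP /bNd.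
have h_eq i j : (h i == h j) = (i == j %[mod N]).
  rewrite /h; case: (eqVneq (odd i) (odd j)) => [eij | nij]; last first.
    have -> : (i == j %[mod N]) = false.
      apply/negP => /eqP /(congr1 odd).
      by rewrite !odd_mod ?(negbTE Nodd) // => /eqP; rewrite (negbTE nij).
    by case: (odd i) (odd j) nij => [] [] //= _; rewrite 1?eq_sym h_neq.
  rewrite -[i in RHS]odd_double_half -[j in RHS]odd_double_half eij eqn_modDl.
  rewrite defN -!mul2n -!muln_modr eqn_pmul2l // -(has_order_eq _ _ od).
  by case: (odd j) => //; rewrite (inj_eq (addrI b)) eqr_opp.
have gen v := has_order_generates os v.
have genb v : exists k, v == s *+ k by have [k ->] := gen v; exists k.
(* The choice of exponent is harmless, as [h] depends only on [k] modulo [N]. *)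
pose l v := h (xchoose (genb v)).
have lE k : l (s *+ k) = h k.
  by apply/eqP; rewrite h_eq -(has_order_eq _ _ os) eq_sym (xchooseP (genb _)).
exists l; split.
  apply: inj_card_bij; last by rewrite cG.
  move=> u v; have [i ->] := gen u; have [j ->] := gen v.
  by rewrite !lE => /eqP; rewrite h_eq -(has_order_eq _ _ os) => /eqP.
have [j tj] := has_order_generates os t.
(* For even [j], [(N/2)t = (N/2)js] would be a multiple of [Ns = 0], against the order of [t]. *)
have j_odd : odd j.
  apply: contraLR isT => j_even; rewrite -(odd_double_half j) (negbTE j_even) in tj.
  have : t *+ N./2 == 0.
    by rewrite tj -mulrnA add0n -doubleMl doubleMr -defN os dvdn_mull.
  rewrite ot => /(dvdn_leq M_gt0); rewrite {1}defN -addnn.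
  by rewrite -[X in (_ <= X)%N]addn0 leq_add2l leqNgt M_gt0.
have pair k : h k + h k.+1 = if odd k then b + d else b.
  rewrite /h /= uphalf_half; case: (odd k) => /=.
    by rewrite add1n mulrS addrACA addNr addr0.
  by rewrite add0n addrC subrK.
(* Since [j] is odd, [k] and [k + j] have opposite parities, so one pair sums to [b] and the other
   to [b + d]. *)
exists (b + d + b) => v; have [k ->] := gen v.
rewrite tj -mulrnDr -!mulrSr !lE !pair oddD j_odd addbT.
by case: (odd k) => //=; rewrite addrC.
Qed.

(** * The torus as the group of vertices *)

Lemma ordS_addr1 p (i : 'I_p.+3) : ordS i = i + 1.
Proof. by apply: val_inj; rewrite /= modnDmr addn1. Qed.

Lemma cycle_graphE p (i j : 'I_p.+3) :
  cycle_graph i j = (j == i + 1) || (j == i - 1).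
Proof.
by rewrite /cycle_graph !ordS_addr1; congr (_ || _); rewrite eq_sym -subr_eq opprK.
Qed.

Lemma has_order_Zp1 p : has_order (1 : 'I_p.+3) p.+3.
Proof. by move=> k; rewrite Zp_mulrn -val_eqE /= modnMml mul1n. Qed.

Lemma Zp3_one_neq_opp1 p : (1 == -1 :> 'I_p.+3) = false.
Proof. by rewrite -addr_eq0 -mulr2n has_order_Zp1 gtnNdvd. Qed.

Lemma torus_neighborhood_sum p q (Gamma : finZmodType)
    (l : 'I_p.+3 * 'I_q.+3 -> Gamma) v :
  \sum_(u in open_neighborhood
      (cartesian_product (@cycle_graph p.+3) (@cycle_graph q.+3)) v) l u =
  (l (v - (1, 0)) + l (v - (0, 1))) + (l (v + (0, 1)) + l (v + (1, 0))).
Proof.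
case: v => i j; have -> : open_neighborhood
    (cartesian_product (@cycle_graph p.+3) (@cycle_graph q.+3)) (i, j) =
  [set (i - 1, j); (i, j - 1); (i, j + 1); (i + 1, j)].
  apply/setP => -[x y]; rewrite !inE /cartesian_product /= !cycle_graphE !xpair_eqE.
  rewrite [i == x]eq_sym [j == y]eq_sym.
  by do ![case: eqP => //= ?].
(* The four neighbors are distinct because [1] and [2] are nonzero modulo any length at least 3, so
   the sum splits into four terms. *)
have addr_eq r (x a : 'I_r.+3) : (x + a == x) = (a == 0).
  by rewrite -subr_eq0 addrAC subrr add0r.
have neq2 : (j - 1 == j + 1) = false.
  by rewrite (inj_eq (addrI j)) eq_sym Zp3_one_neq_opp1.
have neq3 : (i - 1 == i + 1) = false.
  by rewrite (inj_eq (addrI i)) eq_sym Zp3_one_neq_opp1.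
rewrite -!setUA !big_setU1 ?big_set1 /= ?inE ?xpair_eqE ?neq2 ?neq3 ?addr_eq ?oppr_eq0
  ?andbF //.
rewrite !addrA; congr (l _ + l _ + l _ + l _); apply/eqP; rewrite xpair_eqE /=;
  by rewrite ?oppr0 ?addr0 !eqxx.
Qed.

Lemma torus_magic_labelingE p q (Gamma : finZmodType)
    (l : 'I_p.+3 * 'I_q.+3 -> Gamma) :
  distance_magic_labeling
    (cartesian_product (@cycle_graph p.+3) (@cycle_graph q.+3)) l <->
  bijective l /\ magic_for_generators (1, -1) (1, 1) l.
Proof.
have shift v : (l v + l (v + (1, -1))) + (l (v + (1, 1)) + l (v + (1, 1) + (1, -1))) =
  \sum_(u in open_neighborhood
      (cartesian_product (@cycle_graph p.+3) (@cycle_graph q.+3)) (v + (1, 0))) l u.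
  rewrite torus_neighborhood_sum; case: v => i j.
  congr ((l _ + l _) + (l _ + l _)); apply/eqP; rewrite xpair_eqE /=;
    by rewrite ?(addr0, subr0, oppr0, add0r, addrK, addrNK, eqxx).
split=> -[l_bij [mu lmu]]; split=> //; exists mu => v; first by rewrite shift.
by rewrite -[v](subrK (1, 0)) -shift.
Qed.

(** Each coordinate has order equal to its cycle length; coprimality makes the order of the pair
    their product. *)
Lemma has_order_torus_generators p q : coprime p.+3 q.+3 ->
  has_order ((1, 1) : 'I_p.+3 * 'I_q.+3) (p.+3 * q.+3) /\
  has_order ((1, -1) : 'I_p.+3 * 'I_q.+3) (p.+3 * q.+3).
Proof.
move=> pq; split=> k; rewrite pairMnE xpair_eqE /= ?mulNrn ?oppr_eq0 !has_order_Zp1;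
  by rewrite Gauss_dvd.
Qed.

Theorem mainTheorem3 (m n : nat) (hm : (3 <= m)%N) (hn : (3 <= n)%N)
    (hmn : coprime m n) (Gamma : finZmodType) (hG : #|Gamma| = (m * n)%N) :
  (exists l : 'I_m * 'I_n -> Gamma,
     distance_magic_labeling
       (cartesian_product (@cycle_graph m) (@cycle_graph n)) l)
  <->
  (~~ odd (m * n) /\
   (isomorphic_zmod Gamma ('Z_2 * 'Z_((m * n) %/ 2))%type \/
    isomorphic_zmod Gamma 'Z_(m * n))).
Proof.
case: m hm hmn hG => [|[|[|p]]] // _; case: n hn => [|[|[|q]]] // _ pq hG.
have [ot os] := has_order_torus_generators pq.
pose V : finZmodType := ('I_p.+3 * 'I_q.+3)%type.
have cV : #|V| = (p.+3 * q.+3)%N by rewrite card_prod !card_ord.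
move: hG ot os; rewrite -cV => hG ot os.
have N_gt2 : (2 < #|V|)%N by rewrite cV mulSn.
have main : (exists l : V -> Gamma, bijective l /\
      magic_for_generators ((1, -1) : V) (1, 1) l) <->
    ~~ odd #|V| /\ index2_cyclic Gamma.
  split=> [[l [/bij_inj l_inj lmu]] | [N_even G2]].
    exact: magic_index2_cyclic lmu.
  exact: index2_cyclic_magic.
split=> [[l /torus_magic_labelingE lP] | [N_even /(index2_cyclic_iff N_gt2 hG N_even) G2]].
  have [N_even G2] := main.1 (ex_intro _ l lP); split=> //; exact/index2_cyclic_iff.
by have [l /torus_magic_labelingE lP] := main.2 (conj N_even G2); exists l.
Qed.
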